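(* For generic $u_1,u_2,v_1,v_2$, the operator $\check{\mathbb{R}}(u_1,u_2|v_1,v_2)$ on $\mathbb{C}[z_1,z_2]$ solving $$\check{\mathbb{R}}(u_1,u_2|v_1,v_2)\,\mathrm{L}_{1}(u_1,u_2)\,\mathrm{L}_{2}(v_1,v_2)=\mathrm{L}_{1}(v_1,v_2)\,\mathrm{L}_{2}(u_1,u_2)\,\check{\mathbb{R}}(u_1,u_2|v_1,v_2)$$ can be factorized as $$\check{\mathbb{R}}(u_1,u_2|v_1,v_2)=\mathcal{R}_1(u_1|v_1,u_2)\,\mathcal{R}_2(u_1,u_2|v_2)=\mathcal{R}_2(v_1,u_2|v_2)\,\mathcal{R}_1(u_1|v_1,v_2),$$ where the equalities are understood up to nonzero scalar normalization factors. That is, the two products coincide (up to normalization) and give a solution $\check{\mathbb{R}}$ of the displayed equation.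
   Context: Notation: $\partial_k=\partial/\partial z_k$, $z_{12}=z_1-z_2$, $z_{21}=z_2-z_1$. For complex parameters $a,b$ and $k\in\{1,2\}$ the Lax operator is the $2\times2$ matrix of differential operators on $\mathbb{C}[z_1,z_2]$ $$\mathrm{L}_k(a,b)=\begin{pmatrix} a+z_k\partial_k & -\partial_k\\ z_k^2\partial_k+(a-b)z_k & b-z_k\partial_k\end{pmatrix}.$$ Products of such matrices are matrix products with operator entries, $(\mathrm{L}_1\mathrm{L}_2)_{ik}=\sum_j(\mathrm{L}_1)_{ij}(\mathrm{L}_2)_{jk}$, and an operator on $\mathbb{C}[z_1,z_2]$ placed to the left or right of a matrix multiplies (composes with) each entry from that side. Parameters are complex and generic: no pairwise difference of $u_1,u_2,v_1,v_2$ is an integer. The operators $\mathcal{R}_1,\mathcal{R}_2$ on $\mathbb{C}[z_1,z_2]$ are, up to scalar normalization, $$\mathcal{R}_1(a|b,c)=\frac{\Gamma(z_{21}\partial_2+a-c)}{\Gamma(z_{21}\partial_2+b-c)},\qquad \mathcal{R}_2(a,b|c)=\frac{\Gamma(z_{12}\partial_1+a-c)}{\Gamma(z_{12}\partial_1+a-b)},$$ where $f(z_{21}\partial_2)$ denotes the operator $z_1^jz_{21}^k\mapsto f(k)z_1^jz_{21}^k$ and $f(z_{12}\partial_1)$ the operator $z_2^jz_{12}^k\mapsto f(k)z_2^jz_{12}^k$ ($j,k\ge0$). They satisfy $\mathcal{R}_{1}(u_1|v_1,v_2)\mathrm{L}_{1}(u_1,u_2)\mathrm{L}_{2}(v_1,v_2)=\mathrm{L}_{1}(v_1,u_2)\mathrm{L}_{2}(u_1,v_2)\mathcal{R}_{1}(u_1|v_1,v_2)$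 and $\mathcal{R}_{2}(u_1,u_2|v_2)\mathrm{L}_{1}(u_1,u_2)\mathrm{L}_{2}(v_1,v_2)=\mathrm{L}_{1}(u_1,v_2)\mathrm{L}_{2}(v_1,u_2)\mathcal{R}_{2}(u_1,u_2|v_2)$. *)

(* Defs.v *)
(* MathComp / MathComp-Analysis: the complex numbers are [R[i]] for an arbitrary
   [R : realType], and C[z_1, z_2] is the ring of polynomials in two variables
   'X_0 = z_1 and 'X_1 = z_2 of the multinomials library.  The notations of
   [mpoly] clash with those of MathComp-Analysis and are left out. *)
From HB Require Import structures.
From mathcomp Require Import all_boot all_order all_algebra.
From mathcomp Require Import complex.
From mathcomp Require Import all_classical all_reals all_analysis.
From mathcomp Require Import -(notations) mpoly.

Set Implicit Arguments.
Unset Strict Implicit.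
Unset Printing Implicit Defensive.

Import Order.TTheory GRing.Theory Num.Theory.
Import numFieldNormedType.Exports.

Local Open Scope classical_set_scope.
Local Open Scope complex_scope.
Local Open Scope ring_scope.

Notation polyz K := (mpoly 2 K).

Definition i1 : 'I_2 := ord0.
Definition i2 : 'I_2 := ord_max.

Section Gamma.
Variable R : realType.
Implicit Types z : R[i].

Definition expC z : R[i] :=
  (expR (complex.Re z) * cos (complex.Im z)) +i*
  (expR (complex.Re z) * sin (complex.Im z)).

(* n ^ z = exp (z * ln n) with the real logarithm; relevant for n > 0. *)
Definition natpowC (n : nat) z : R[i] := expC (z * (ln (n%:R : R))%:C).

Definition Gamma_seq z (n : nat) : R[i]^o :=
  n`!%:R * natpowC n z / \prod_(0 <= i < n.+1) (z + i%:R).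

(* Euler's limit formula, valid on the whole of C \ {0, -1, -2, ...}; the
   topology on [R[i]^o] is that of the modulus. *)
Definition Gamma z : R[i] := lim (Gamma_seq z n @[n --> \oo]).

End Gamma.

Section Operators.
Variable K : comNzRingType.
Local Notation P := (polyz K).
Implicit Types (a b c : K) (f : nat -> K) (p q : P) (k l : 'I_2).

Definition zvar k : P := mpolyX K (mnm1 k).

(* Matrices of operators, composition being the product of entries. *)
Definition opmx := 'M[P -> P]_2.

Definition mul_opmx (A B : opmx) : opmx :=
  \matrix_(i, k) fun p => \sum_j A i j (B j k p).

Definition lcomp_opmx (T : P -> P) (A : opmx) : opmx :=
  \matrix_(i, j) (T \o A i j).

Definition rcomp_opmx (A : opmx) (T : P -> P) : opmx :=
  \matrix_(i, j) (A i j \o T).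

Definition Lax k a b : opmx :=
  \matrix_(i, j)
    match val i, val j with
    | 0, 0 => fun p => a *: p + zvar k * mderiv k p
    | 0, _ => fun p => - mderiv k p
    | _, 0 => fun p => zvar k ^+ 2 * mderiv k p + (a - b) *: (zvar k * p)
    | _, _ => fun p => b *: p - zvar k * mderiv k p
    end.

(* For k != l, [zdfun f k l] is the operator f(z_{kl} d/dz_k), where
   z_{kl} = z_k - z_l, that is z_l^s z_{kl}^r |-> f(r) z_l^s z_{kl}^r
   (lemma [zdfunE] below).  [p] is expanded in this basis by substituting
   w + z_l for z_k, where the role of w is played by the variable 'X_k. *)
Definition zdsubst k l p : P :=
  comp_mpoly [tuple if i == k then zvar k + zvar l else zvar i | i < 2] p.

Definition zdfun f k l p : P :=
  let q := zdsubst k l p in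
  \sum_(m <- msupp q)
    (mcoeff m q * f (m k)) *: (zvar l ^+ m l * (zvar k - zvar l) ^+ m k).

Fact zdfun_is_linear f k l : linear (zdfun f k l).
Proof.
pose T m := f (m k) *: (zvar l ^+ m l * (zvar k - zvar l) ^+ m k).
have E w p : (msize (zdsubst k l p) <= w)%N ->
    zdfun f k l p = \sum_(m : bmultinom 2 w) mcoeff m (zdsubst k l p) *: T m.
  move=> le_w; pose I : subFinType _ := bmultinom 2 w.
  rewrite /zdfun /= (ssrcomplements.big_mksub I) ?msupp_uniq //=; last first.
    by move=> x /msize_mdeg_lt /leq_trans; apply.
  rewrite big_rmcond //=; last first.
    by move=> m /memN_msupp_eq0 ->; rewrite mul0r scale0r.
  by apply: eq_bigr => m _; rewrite /T scalerA.
move=> a p q.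
pose w := maxn (msize (zdsubst k l (a *: p + q)))
               (maxn (msize (zdsubst k l p)) (msize (zdsubst k l q))).
have le1 : (msize (zdsubst k l (a *: p + q)%R) <= w)%N by exact: leq_maxl.
have le2 : (msize (zdsubst k l p) <= w)%N.
  exact: leq_trans (leq_maxl _ _) (leq_maxr _ _).
have le3 : (msize (zdsubst k l q) <= w)%N.
  exact: leq_trans (leq_maxr _ _) (leq_maxr _ _).
rewrite (E w _ le1) (E w _ le2) (E w _ le3).
rewrite scaler_sumr -big_split /=; apply: eq_bigr => m _.
have -> : mcoeff m (zdsubst k l (a *: p + q)) =
    a * mcoeff m (zdsubst k l p) + mcoeff m (zdsubst k l q).
  rewrite -mcoeffZ -mcoeffD; congr (mcoeff _ _).
  by rewrite /zdsubst comp_mpolyD comp_mpolyZ.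
by rewrite scalerDl -scalerA.
Qed.

HB.instance Definition _ f k l :=
  GRing.isLinear.Build K P P *:%R (zdfun f k l) (zdfun_is_linear f k l).

Lemma zdfunE f k l (s r : nat) : k != l ->
  zdfun f k l (zvar l ^+ s * (zvar k - zvar l) ^+ r) =
  f r *: (zvar l ^+ s * (zvar k - zvar l) ^+ r).
Proof.
move=> kl.
have lk : (l == k) = false by rewrite eq_sym; apply/negbTE.
pose m := mnm_add (mnm_muln (mnm1 l) s) (mnm_muln (mnm1 k) r).
have -> : zdfun f k l (zvar l ^+ s * (zvar k - zvar l) ^+ r) =
    \sum_(m0 <- msupp (mpolyX K m)) (mcoeff m0 (mpolyX K m) * f (m0 k)) *:
      (zvar l ^+ m0 l * (zvar k - zvar l) ^+ m0 k).
  rewrite /zdfun /=; suff -> : zdsubst k l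
    (zvar l ^+ s * (zvar k - zvar l) ^+ r) = mpolyX K m by [].
  rewrite /zdsubst rmorphM !rmorphXn rmorphB /=.
  rewrite !comp_mpolyXU -!tnth_nth !tnth_mktuple eqxx lk addrK.
  by rewrite /zvar !mpolyXn mpolyXD.
rewrite msuppX big_seq1 mcoeffX eqxx mul1r.
by rewrite !mnmDE !mulmnE !mnm1E !eqxx lk (negbTE kl) !(mul0n, mul1n, addn0).
Qed.

End Operators.

Section ROperators.
Variable R : realType.
Local Notation C := R[i].
Implicit Types a b c : C.

Definition calR1 a b c : {linear polyz C -> polyz C} :=
  zdfun (fun r => Gamma (r%:R + a - c) / Gamma (r%:R + b - c)) i2 i1.

Definition calR2 a b c : {linear polyz C -> polyz C} :=
  zdfun (fun r => Gamma (r%:R + a - c) / Gamma (r%:R + a - b)) i1 i2.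

Definition nonint_diff a b := forall n : int, a - b != n%:~R.

Definition generic (u1 u2 v1 v2 : C) : Prop :=
  [/\ nonint_diff u1 u2, nonint_diff u1 v1 & nonint_diff u1 v2] /\
  [/\ nonint_diff u2 v1, nonint_diff u2 v2 & nonint_diff v1 v2].

End ROperators.

(* Main.v *)
Require Import Defs.
From mathcomp Require Import all_boot all_order all_algebra.
From mathcomp Require Import complex.
From mathcomp Require Import all_classical all_reals all_analysis.
From mathcomp Require Import -(notations) mpoly.
From mathcomp Require Import ring lra.

(** Take for the solution the product of the two elementary operators, first
    [calR2] and then [calR1].

    Existence. Each elementary operator exchanges two of the four parameters
    in the product of Lax matrices, so performing two exchanges in a row
    gives the intertwining relation. One exchange is proved by writing each
    Lax matrix as a triangular matrix conjugated by the unipotent matrix with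
    lower entry z_k. After conjugating the whole product by the unipotent
    matrix of the one variable x that the elementary operator commutes with,
    its entries are polynomials in w = z_k - z_l, in d_k and in the
    translation generator d_k + d_l ([Lax_mul1], [Lax_mul2]). A function f of
    the Euler operator w d_k commutes with x, w d_k and d_k + d_l, and it
    passes through the entries that raise or lower the degree in w exactly
    when f satisfies the first-order recurrence
    (r + beta) f(r + 1) = (r + alpha) f(r), at the cost of swapping alpha and
    beta ([zdfun_raise], [zdfun_lower]); this swap is the exchange of
    parameters.
    A ratio of two Gamma functions satisfies it by the functional equation.

    Coincidence of the two products. Both of them intertwine the same two
    families of Lax products, since adding one number h to all four parameters
    leaves the elementary operators unchanged. For h chosen to cancel one of
    two terms, the lower left entry of the product sends the monomial
    z_1^i z_2^j to a multiple of z_1^(i+1) z_2^j or of z_1^i z_2^(j+1), and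
    genericity makes the multiple nonzero ([Lax_mul_raise]). So every monomial
    is reached from 1, and an intertwiner is determined by its value at 1
    ([intertwiner_unique]). Both products send 1 to
    Gamma(u1 - v2) / Gamma(v1 - u2) times 1, because the other Gamma values
    cancel.

    The last cancellation and the recurrence need the Euler limit to exist, to
    be nonzero and to satisfy Gamma(z + 1) = z Gamma(z). Consecutive terms of
    the Euler sequence have a ratio 1 + O(1/n^2), and so do their inverses;
    hence the sequence and its inverse both converge ([Gamma_seq_cvg]), which
    forces a nonzero limit. *)

Set Implicit Arguments.
Unset Strict Implicit.
Unset Printing Implicit Defensive.
Import Order.TTheory GRing.Theory Num.Theory.
Import numFieldNormedType.Exports.
Local Open Scope classical_set_scope.
Local Open Scope complex_scope.
Local Open Scope ring_scope.

(** * Convergence of complex sequences *)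

Section ComplexSequences.
Variable R : realType.
Implicit Types (x y : R) (w z : R[i]).
Import ComplexField.Normc.

Lemma normc_le x y : normc (x +i* y) <= `|x| + `|y|.
Proof.
rewrite /= -[leRHS]ger0_norm ?addr_ge0// -sqrtr_sqr ler_wsqrtr//.
rewrite -(real_normK (num_real x)) -(real_normK (num_real y)).
by rewrite sqrrD lerD2r lerDl mulrn_wge0// mulr_ge0.
Qed.

Lemma normc_ge0 z : 0 <= normc z.
Proof. by case: z => x y; exact: sqrtr_ge0. Qed.

Lemma sqr_normcE x y : normc (x +i* y) ^+ 2 = x ^+ 2 + y ^+ 2.
Proof. by rewrite sqr_sqrtr ?addr_ge0 ?sqr_ge0. Qed.

Lemma ler_Re_normc z : `|complex.Re z| <= normc z.
Proof.
case: z => x y /=; rewrite -sqrtr_sqr ler_wsqrtr// lerDl; exact: sqr_ge0.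
Qed.

Lemma ler_Im_normc z : `|complex.Im z| <= normc z.
Proof.
case: z => x y /=; rewrite -sqrtr_sqr ler_wsqrtr// lerDr; exact: sqr_ge0.
Qed.

Lemma normcB_ge w z : normc w - normc z <= normc (w + z).
Proof.
rewrite lerBlDr; have := le_normcD (w + z) (- z).
by rewrite addrK normcN.
Qed.

(** Completeness of the complex numbers is obtained from that of the reals
    through real and imaginary parts. *)
Lemma cvg_complex (f : nat -> R[i]) w :
  complex.Re (f n) @[n --> \oo] --> complex.Re w ->
  complex.Im (f n) @[n --> \oo] --> complex.Im w ->
  (f n : R[i]^o) @[n --> \oo] --> (w : R[i]^o).
Proof.
move=> /cvgrPdist_lt cvRe /cvgrPdist_lt cvIm; apply/cvgrPdist_lt => /= e e0.
have eE : e = (complex.Re e)%:C by rewrite RRe_real// gtr0_real.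
have {}e0 : 0 < complex.Re e by move: e0; rewrite {1}eE ltcR.
near=> n.
rewrite eE -[X in X < _]/(normc (w - f n))%:C ltcR.
have -> : w - f n = (complex.Re w - complex.Re (f n)) +i*
                   (complex.Im w - complex.Im (f n)).
  by case: (w) => ? ?; case: (f n).
apply: le_lt_trans (normc_le _ _) _.
rewrite (splitr (complex.Re e)) ltrD//; near: n.
- by apply: cvRe; rewrite divr_gt0.
- by apply: cvIm; rewrite divr_gt0.
Unshelve. all: by end_near. Qed.

Lemma cvg_real_complex (f : nat -> R) x : f n @[n --> \oo] --> x ->
  ((f n)%:C : R[i]^o) @[n --> \oo] --> (x%:C : R[i]^o).
Proof. by move=> cvf; apply: cvg_complex => //=; exact: cvg_cst. Qed.

(** Subtracting and adding C / (n + 1) turns f into two adjacent monotone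
    sequences. The increment bound C / ((n + 1) (n + 2)) is written as a
    difference of harmonic terms to make this telescope. *)
Lemma cvg_of_harmonic_increments (f : nat -> R) C :
  (forall n, `|f n.+1 - f n| <= C * (harmonic n - harmonic n.+1)) -> cvgn f.
Proof.
move=> df.
pose u n := f n - C * harmonic n; pose v n := f n + C * harmonic n.
have Ch0 : C * harmonic n @[n --> \oo] --> (0 : R).
  by rewrite -[0](mulr0 C); apply: cvgMr; exact: cvg_harmonic.
have [| | |_ cu _] := @adjacent_seq R u v.
- apply/nondecreasing_seqP => n; rewrite /u.
  by move: (df n); rewrite ler_norml => /andP[lo hi]; lra.
- apply/nonincreasing_seqP => n; rewrite /v.
  by move: (df n); rewrite ler_norml => /andP[lo hi]; lra.
- have -> : v - u = (fun n => C * harmonic n) \+ (fun n => C * harmonic n).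
    apply/funext => n.
    change (v n - u n = C * harmonic n + C * harmonic n).
    by rewrite /v /u; ring.
  by rewrite -[0](addr0 0); apply: cvgD.
have -> : f = u \+ (fun n => C * harmonic n).
  by apply/funext => n; rewrite /u /= subrK.
by apply: is_cvgD => //; apply/cvg_ex; exists 0.
Qed.

(** The relative bound gives an absolute one, because [a] is bounded: its
    modulus times exp (C / (n + 1)) is nonincreasing. *)
Lemma cvgC_of_increments (a : nat -> R[i]) C : 0 <= C ->
  (forall n, normc (a n.+1 - a n) <=
     C * (harmonic n - harmonic n.+1) * normc (a n)) ->
  exists l : R[i], (a n : R[i]^o) @[n --> \oo] --> (l : R[i]^o).
Proof.
move=> C0 da.
pose h n : R := harmonic n - harmonic n.+1.
have h0 n : 0 <= h n.
  by rewrite subr_ge0 /= lef_pV2 ?posrE ?ltr0n// ler_nat.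
pose b n := normc (a n) * expR (C * harmonic n).
have bS n : b n.+1 <= b n.
  have : normc (a n.+1) <= expR (C * h n) * normc (a n).
    have -> : a n.+1 = a n + (a n.+1 - a n) by rewrite addrC subrK.
    apply: le_trans (le_normcD _ _) _.
    apply: le_trans (lerD (lexx _) (da n)) _.
    rewrite -[X in X + _]mul1r -mulrDl ler_wpM2r ?normc_ge0//.
    exact: expR_ge1Dx.
  move=> /(ler_wpM2r (expR_ge0 (C * harmonic n.+1))) /le_trans; apply.
  by rewrite mulrAC -expRD -mulrDr /h subrK mulrC.
have b_le n : b n <= b 0.
  by elim: n => // n IH; exact: le_trans (bS n) IH.
have a_le n : normc (a n) <= b 0.
  apply: le_trans (b_le n); rewrite ler_peMr ?normc_ge0//.
  by rewrite -expR0 ler_expR mulr_ge0// harmonic_ge0.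
have da' n : normc (a n.+1 - a n) <= C * b 0 * h n.
  apply: le_trans (da n) _; rewrite -/(h n) [leRHS]mulrAC.
  by rewrite ler_wpM2l ?mulr_ge0 ?h0.
have /cvg_ex[x cx] : cvgn (fun n => complex.Re (a n)).
  apply: (@cvg_of_harmonic_increments _ (C * b 0)) => n.
  by rewrite -raddfB; apply: le_trans (ler_Re_normc _) (da' n).
have /cvg_ex[y cy] : cvgn (fun n => complex.Im (a n)).
  apply: (@cvg_of_harmonic_increments _ (C * b 0)) => n.
  by rewrite -raddfB; apply: le_trans (ler_Im_normc _) (da' n).
by exists (x +i* y); apply: cvg_complex.
Qed.

(** An infinite product of factors p / q that are close to 1. The hypotheses are
    symmetric in p and q, so they also apply to the inverse of [a]; the two
    limits are then inverse to each other. *)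
Lemma cvg_quotient_product (a p q : nat -> R[i]) D : 0 <= D ->
  (forall n, a n != 0) ->
  (forall n, a n.+1 * q n = a n * p n) ->
  (forall n, 2^-1 <= normc (p n)) -> (forall n, 2^-1 <= normc (q n)) ->
  (forall n, normc (p n - q n) <= D * (harmonic n - harmonic n.+1)) ->
  exists2 l : R[i], l != 0 & (a n : R[i]^o) @[n --> \oo] --> (l : R[i]^o).
Proof.
move=> D0 a0 apq p2 q2 pq.
have ge2_neq0 (w : R[i]) : 2^-1 <= normc w -> w != 0.
  by apply: contraTneq => ->; rewrite normc0 -ltNge invr_gt0.
have quo (u v : R[i]) (x : R) : 2^-1 <= normc v -> normc (u - v) <= x ->
    normc (u / v - 1) <= 2 * x.
  move=> v2 uv; have v0 := ge2_neq0 _ v2.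
  have -> : u / v - 1 = (u - v) / v by rewrite mulrBl divff.
  rewrite normcM normcV mulrC ler_pM ?normc_ge0 ?invr_ge0 ?normc_ge0//.
  by rewrite -[leRHS]invrK lef_pV2 ?posrE ?invr_gt0//; apply: lt_le_trans v2.
have aE n : a n.+1 = a n * (p n / q n).
  by rewrite mulrA -apq mulfK// ge2_neq0.
have [l cl] : exists l : R[i], (a n : R[i]^o) @[n --> \oo] --> (l : R[i]^o).
  apply: (@cvgC_of_increments _ (2 * D)); first by rewrite mulr_ge0.
  move=> n; have -> : a n.+1 - a n = a n * (p n / q n - 1).
    by rewrite mulrBr mulr1 aE.
  by rewrite normcM mulrC ler_wpM2r ?normc_ge0// -mulrA quo.
have [l' cl'] : exists l : R[i],
    ((a n)^-1 : R[i]^o) @[n --> \oo] --> (l : R[i]^o).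
  apply: (@cvgC_of_increments _ (2 * D)); first by rewrite mulr_ge0.
  move=> n; have -> : (a n.+1)^-1 - (a n)^-1 = (a n)^-1 * (q n / p n - 1).
    rewrite mulrBr mulr1; congr (_ - _).
    by rewrite aE invfM invf_div.
  rewrite normcM mulrC ler_wpM2r ?normc_ge0// -mulrA quo//.
  by rewrite -normcN opprB.
exists l => //; apply/eqP => l0.
have c0 : (1 : R[i]^o) @[_ --> \oo] --> (0 : R[i]^o).
  rewrite (_ : (fun _ : nat => 1 : R[i]^o) = fun n => a n / a n).
    by rewrite -(mul0r l') -l0; exact: cvgM cl cl'.
  by apply/funext => n; rewrite mulfV.
have : (1 : R[i]^o) = 0.
  by apply: (cvg_unique (@norm_hausdorff _ R[i]^o) _ c0); exact: cvg_cst.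
by move/eqP; rewrite oner_eq0.
Qed.

End ComplexSequences.

(** * Estimates for the complex exponential *)

Section ComplexExponential.
Variable R : realType.
Implicit Types (x y : R) (w z : R[i]).
Import ComplexField.Normc.

Lemma expCD w z : expC (w + z) = expC w * expC z.
Proof.
case: w z => [a b] [c d]; rewrite /expC /= expRD cosD sinD.
by apply/eqP; rewrite eq_complex /=; apply/andP; split; apply/eqP; ring.
Qed.

Lemma normc_expC w : normc (expC w) = expR (complex.Re w).
Proof.
rewrite /expC /= !exprMn -mulrDr cos2Dsin2 mulr1 sqrtr_sqr.
by rewrite ger0_norm ?expR_ge0.
Qed.

Lemma expC_neq0 w : expC w != 0.
Proof.
apply/eqP => /(congr1 (@normc R)); rewrite normc_expC normc0 => /eqP.
by rewrite gt_eqF ?expR_gt0.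
Qed.

(** The mean value theorem, on either side of 0. *)
Lemma lipschitz_at0 (f df : R -> R) (M y : R) :
  (forall x, is_derive x 1 f (df x)) ->
  (forall x, `|x| <= `|y| -> `|df x| <= M) -> `|f y - f 0| <= M * `|y|.
Proof.
move=> fdf dfM.
have fc A : {within A, continuous f}.
  apply: continuous_subspaceT => x; apply: differentiable_continuous.
  by apply/derivable1_diffP; case: (fdf x).
have [y0|y0] := leP 0 y.
  have [c c0y ->] := MVT_segment y0 (fun x _ => fdf x) (fc _).
  rewrite subr0 normrM ler_wpM2r// dfM//.
  by move: c0y; rewrite in_itv /= => /andP[c0 cy]; rewrite !ger0_norm.
have [c cy0 E] := MVT_segment (ltW y0) (fun x _ => fdf x) (fc _).
rewrite distrC E sub0r normrM normrN ler_wpM2r// dfM//.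
move: cy0; rewrite in_itv /= => /andP[yc c0].
by rewrite !ler0_norm ?lerN2// ltW.
Qed.

Lemma ler_norm_sin y : `|sin y| <= `|y|.
Proof.
have := @lipschitz_at0 sin cos 1 y (fun x => is_derive_sin x)
  (fun x _ => cos_max x).
by rewrite sin0 subr0 mul1r.
Qed.

Lemma ler_cos_sub1 y : `|cos y - 1| <= y ^+ 2.
Proof.
have := @lipschitz_at0 cos (fun x => - sin x) `|y| y (fun x => is_derive_cos x).
rewrite cos0 -expr2 real_normK ?num_real//; apply => x xy.
by rewrite normrN (le_trans (ler_norm_sin _)).
Qed.

Lemma ler_sin_subid y : `|y| <= 1 -> `|sin y - y| <= y ^+ 2.
Proof.
move=> y1.
have := @lipschitz_at0 (fun x => sin x - x) (fun x => cos x - 1) `|y| y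
  (fun x => is_deriveB _ _).
rewrite sin0 !subr0 -expr2 real_normK ?num_real//; apply => x xy.
apply: le_trans (ler_cos_sub1 _) _; rewrite -real_normK ?num_real//.
by apply: (le_trans _ xy); rewrite expr2 ler_piMl// (le_trans xy).
Qed.

(** The upper bound comes from exp x <= 1 / (1 - x), that is, from the lower
    bound exp (- x) >= 1 - x. *)
Lemma ler_expR_sub1Dx x : `|x| <= 2^-1 -> `|expR x - 1 - x| <= 2 * x ^+ 2.
Proof.
rewrite ler_norml => /andP[lo hi].
have ge := expR_ge1Dx x; rewrite ger0_norm; last by lra.
have := expR_ge1Dx (- x); rewrite expRN => le.
have e0 := expR_gt0 x.
have : (1 - x) * expR x <= 1.
  by rewrite -[leRHS](@mulVf _ (expR x)) ?gt_eqF// ler_wpM2r// ltW.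
nra.
Qed.

Lemma ler_expC_sub1Dw w : normc w <= 2^-1 ->
  normc (expC w - 1 - w) <= 4 * normc w ^+ 2.
Proof.
move=> w2.
have x2 := le_trans (ler_Re_normc w) w2.
have y2 := le_trans (ler_Im_normc w) w2.
move: w x2 y2 {w2} => [x y]; rewrite [complex.Re _]/= [complex.Im _]/= => x2 y2.
rewrite sqr_normcE.
have -> : expC (x +i* y) - 1 - (x +i* y) =
  (expR x * cos y - 1 - x) +i* (expR x * sin y - y).
  by apply/eqP; rewrite eq_complex /= subr0 !eqxx.
apply: le_trans (normc_le _ _) _.
have Ex := ler_expR_sub1Dx x2; have Cy := ler_cos_sub1 y.
have Sy : `|sin y - y| <= y ^+ 2 by apply: ler_sin_subid; lra.
have c1 := cos_max y; have s1 := ler_norm_sin y.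
have Re_le : `|expR x * cos y - 1 - x| <= 2 * x ^+ 2 + 3 / 2 * y ^+ 2.
  have -> : expR x * cos y - 1 - x =
    (expR x - 1 - x) * cos y + (1 + x) * (cos y - 1) by ring.
  apply: le_trans (ler_normD _ _) _; rewrite !normrM lerD//.
    by apply: le_trans Ex; rewrite ler_piMr.
  apply: ler_pM => //; rewrite ler_norml; move: x2; rewrite ler_norml; lra.
have Im_le : `|expR x * sin y - y| <= 2 * (`|x| * `|y|) + y ^+ 2.
  have -> : expR x * sin y - y = (expR x - 1) * sin y + (sin y - y) by ring.
  apply: le_trans (ler_normD _ _) _; rewrite normrM lerD// mulrA ler_pM//.
  have -> : expR x - 1 = (expR x - 1 - x) + x by ring.
  apply: le_trans (ler_normD _ _) _; apply: le_trans (lerD Ex (lexx _)) _.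
  by rewrite -real_normK ?num_real//; have := normr_ge0 x; nra.
apply: le_trans (lerD Re_le Im_le) _.
rewrite -(real_normK (num_real x)) -(real_normK (num_real y)).
have := sqr_ge0 (`|x| - `|y|); nra.
Qed.

End ComplexExponential.

(** * The Euler limit for the Gamma function *)

Section GammaFunction.
Variable R : realType.
Implicit Types (x y : R) (w z : R[i]).
Import ComplexField.Normc.

Definition ln_step (n : nat) : R := ln n.+2%:R - ln n.+1%:R.
(** Dividing z + n + 2 by n + 2 in the ratio of consecutive terms of the Euler
    sequence leaves this denominator, close to the numerator
    exp (z ln_step n). *)
Definition euler_den z (n : nat) : R[i] := 1 + z * ((harmonic n.+1 : R)%:C).

Lemma normc_real x : normc x%:C = `|x|.
Proof. by rewrite /= expr0n addr0 sqrtr_sqr. Qed.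

Lemma ln_succ_bounds n : harmonic n.+1 <= ln_step n <= harmonic n.
Proof.
have n1 : (n.+1%:R : R) \in Num.pos by rewrite posrE ltr0n.
have n2 : (n.+2%:R : R) \in Num.pos by rewrite posrE ltr0n.
have n1_neq0 : (n.+1%:R : R) != 0 by rewrite pnatr_eq0.
have n2_neq0 : (n.+2%:R : R) != 0 by rewrite pnatr_eq0.
apply/andP; split.
  rewrite -lerN2 opprB -ln_div//.
  have -> : n.+1%:R / n.+2%:R = 1 + - harmonic n.+1 :> R.
    by move: n2_neq0; rewrite /= -[n.+2]addn1 natrD => n2_neq0; field.
  apply: le_ln1Dx; rewrite ltrN2 /= invf_lt1 ?ltr0n//.
  by rewrite ltr1n.
rewrite /ln_step -ln_div//.
have -> : n.+2%:R / n.+1%:R = 1 + harmonic n :> R.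
  by rewrite /= -[n.+2]addn1 natrD mulrDl divff// mul1r.
by apply: le_ln1Dx; apply: lt_le_trans (harmonic_ge0 _); rewrite ltrN10.
Qed.

Lemma natpowCS n z :
  natpowC n.+2 z = natpowC n.+1 z * expC (z * (ln_step n)%:C).
Proof.
rewrite /natpowC -expCD -mulrDr -rmorphD /ln_step.
by congr (expC (_ * _%:C)); ring.
Qed.

Lemma harmonic_sub n :
  harmonic n - harmonic n.+1 = (n.+1%:R * n.+2%:R)^-1 :> R.
Proof.
have n1 : (n.+1%:R : R) != 0 by rewrite pnatr_eq0.
have : (n.+2%:R : R) != 0 by rewrite pnatr_eq0.
rewrite /= -[n.+2]addn1 natrD; move: (n.+1%:R : R) n1 => a a0 a1.
by field; rewrite a0 a1.
Qed.

Lemma expC_linear_close z : exists2 D : R, 0 <= D & exists N, forall n,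
  (N <= n)%N -> [/\ 2^-1 <= normc (expC (z * (ln_step n)%:C)),
    2^-1 <= normc (euler_den z n) &
    normc (expC (z * (ln_step n)%:C) - euler_den z n) <=
      D * (harmonic n - harmonic n.+1)].
Proof.
have z0 := normc_ge0 z.
(* The quadratic remainder of the exponential is at most 4 |z|^2 / (n + 1)^2,
   and 1 / (n + 1)^2 is at most 2 / ((n + 1) (n + 2)); the term |z| bounds the
   error made in replacing ln_step n by 1 / (n + 2). *)
exists (8 * normc z ^+ 2 + normc z).
  by rewrite addr_ge0// mulr_ge0// sqr_ge0.
(* From this rank on, |z| / (n + 1) is at most 1/2. *)
exists (Num.truncn (2 * normc z)) => n Nn.
have /andP[hl lh] := ln_succ_bounds n.
have h0 := harmonic_ge0 n.+1 : 0 <= (harmonic n.+1 : R).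
have zh : normc z * harmonic n <= 2^-1.
  have zn : 2 * normc z <= n.+1%:R.
    by apply/ltW/(lt_le_trans (truncnS_gt _)); rewrite ler_nat.
  have n0 : 0 < (n.+1%:R : R) by rewrite ltr0n.
  by rewrite /= ler_pdivrMr//; lra.
have zl : normc (z * (ln_step n)%:C) <= 2^-1.
  rewrite normcM normc_real ger0_norm ?(le_trans h0)//.
  by apply: le_trans zh; rewrite ler_wpM2l.
split.
- rewrite normc_expC; apply: le_trans (expR_ge1Dx _).
  by have := le_trans (ler_Re_normc _) zl; rewrite ler_norml; lra.
- apply: le_trans (normcB_ge _ _); rewrite normc1 normcM normc_real ger0_norm//.
  have : normc z * harmonic n.+1 <= normc z * harmonic n.
    by rewrite ler_wpM2l// (le_trans hl).
  by lra.
- have -> : expC (z * (ln_step n)%:C) - euler_den z n =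
      (expC (z * (ln_step n)%:C) - 1 - z * (ln_step n)%:C) +
      z * (ln_step n - harmonic n.+1)%:C.
    rewrite /euler_den (rmorphB (real_complex R) (ln_step n)) mulrBr opprD.
    by rewrite !addrA subrK.
  apply: le_trans (le_normcD _ _) _.
  rewrite mulrDl lerD//; last first.
    rewrite normcM normc_real ger0_norm ?subr_ge0//.
    by rewrite ler_wpM2l// lerD2r.
  apply: le_trans (ler_expC_sub1Dw zl) _.
  rewrite normcM normc_real exprMn real_normK ?num_real// mulrA.
  have -> : 8 * normc z ^+ 2 = 4 * normc z ^+ 2 * 2 by ring.
  rewrite -[leRHS]mulrA ler_wpM2l ?mulr_ge0 ?sqr_ge0//.
  apply: (@le_trans _ _ (harmonic n ^+ 2)).
    by rewrite ler_pXn2r// nnegrE ?harmonic_ge0// (le_trans h0).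
  rewrite harmonic_sub /= expr2 invfM mulrCA ler_wpM2l ?invr_ge0//.
  rewrite ler_pdivlMr ?ltr0n// mulrC ler_pdivrMr ?ltr0n//.
  by rewrite -natrM ler_nat ltn_Pmull.
Qed.

Lemma prod_addn_neq0 z n : (forall i : nat, z + i%:R != 0) ->
  \prod_(0 <= i < n) (z + i%:R) != 0.
Proof.
by move=> zi; rewrite prodf_seq_neq0; apply/allP => i _; rewrite zi.
Qed.

Lemma Gamma_seq_neq0 z n : (forall i : nat, z + i%:R != 0) ->
  Gamma_seq z n != 0.
Proof.
move=> zi; apply: mulf_neq0; last by rewrite invr_eq0; exact: prod_addn_neq0.
by apply: mulf_neq0 (expC_neq0 _); rewrite pnatr_eq0 -lt0n fact_gt0.
Qed.

Lemma Gamma_seqS z n : (forall i : nat, z + i%:R != 0) ->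
  Gamma_seq z n.+2 * euler_den z n =
  Gamma_seq z n.+1 * expC (z * (ln_step n)%:C).
Proof.
move=> zi; rewrite /Gamma_seq natpowCS factS natrM big_nat_recr//=.
have n2 : (n.+2%:R : R[i]) != 0 by rewrite pnatr_eq0.
have -> : euler_den z n = (z + n.+2%:R) / n.+2%:R.
  by rewrite /euler_den /= fmorphV rmorph_nat mulrDl divff// addrC.
move: (\prod_(0 <= i < n.+2) _) (prod_addn_neq0 n.+2 zi) => p p0.
move: (n.+1`!%:R : R[i]) (n.+2%:R : R[i]) n2 (zi n.+2) => f m m0 zm.
by field; rewrite p0 zm m0.
Qed.

Lemma Gamma_seq_cvg z : (forall i : nat, z + i%:R != 0) ->
  exists2 g : R[i], g != 0 & (Gamma_seq z n) @[n --> \oo] --> (g : R[i]^o).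
Proof.
move=> zi; have [D D0 [N close]] := expC_linear_close z.
have {}close n := close (n + N)%N (leq_addl _ _).
have pq n : normc (expC (z * (ln_step (n + N))%:C) - euler_den z (n + N)) <=
    D * (harmonic n - harmonic n.+1).
  have [_ _ /le_trans] := close n; apply; rewrite ler_wpM2l// !harmonic_sub.
  rewrite lef_pV2 ?posrE ?mulr_gt0 ?ltr0n// -!natrM ler_nat.
  by rewrite leq_mul// !ltnS leq_addr.
have [g g0 cg] := @cvg_quotient_product _ (fun n => Gamma_seq z (n + N).+1)
  (fun n => expC (z * (ln_step (n + N))%:C)) (fun n => euler_den z (n + N)) D D0
  (fun n => Gamma_seq_neq0 _ zi) (fun n => Gamma_seqS _ zi)
  (fun n => let: And3 a _ _ := close n in a)
  (fun n => let: And3 _ b _ := close n in b) pq.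
exists g => //; rewrite -(cvg_shiftn N.+1).
by under eq_fun do rewrite addnS.
Qed.

Lemma GammaE z (g : R[i]) :
  (Gamma_seq z n) @[n --> \oo] --> (g : R[i]^o) -> Gamma z = g.
Proof.
move=> cg.
exact: (@cvg_lim R[i]^o (@norm_hausdorff _ _) _ _ _ _ _ cg).
Qed.

Lemma Gamma_neq0 z : (forall i : nat, z + i%:R != 0) -> Gamma z != 0.
Proof. by move=> /Gamma_seq_cvg[g g0 /GammaE ->]. Qed.

(** The correction factor tends to 1, so in the limit this is the functional
    equation. *)
Lemma Gamma_seq_add1 z n : (forall i : nat, z + i%:R != 0) ->
  Gamma_seq (z + 1) n.+1 * (1 + (z + 1) * (harmonic n : R)%:C) =
  z * Gamma_seq z n.+1.
Proof.
move=> zi; rewrite /Gamma_seq.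
have z0 : z != 0 by have := zi 0; rewrite addr0.
have n1 : (n.+1%:R : R[i]) != 0 by rewrite pnatr_eq0.
have -> : natpowC n.+1 (z + 1) = natpowC n.+1 z * n.+1%:R :> R[i].
  rewrite /natpowC mulrDl expCD mul1r; congr (_ * _).
  rewrite /expC /= cos0 sin0 mulr0 mulr1 lnK ?posrE ?ltr0n//.
  exact: (rmorph_nat (real_complex R)).
have -> : \prod_(0 <= i < n.+2) (z + 1 + i%:R) =
    \prod_(0 <= i < n.+2) (z + i%:R) * (z + n.+2%:R) / z :> R[i].
  rewrite -big_nat_recr//= [X in _ = X / z]big_nat_recl//= addr0 mulrAC divff//.
  by rewrite mul1r; apply: eq_bigr => i _; rewrite -addrA nat1r.
have -> : 1 + (z + 1) * (harmonic n : R)%:C = (z + n.+2%:R) / n.+1%:R.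
  rewrite /= fmorphV rmorph_nat -[n.+2]addn1 natrD.
  by move: (n.+1%:R : R[i]) n1 => m m0; field.
move: (\prod_(0 <= i < n.+2) _) (prod_addn_neq0 n.+2 zi) => p p0.
move: (n.+1`!%:R : R[i]) (n.+1%:R : R[i]) n1 (n.+2%:R : R[i]) (zi n.+2).
by move=> f m m0 m' zm; field; rewrite p0 zm m0 z0.
Qed.

Lemma GammaS z : (forall i : nat, z + i%:R != 0) -> Gamma (z + 1) = z * Gamma z.
Proof.
move=> zi.
have [g _ cg] := Gamma_seq_cvg zi; rewrite (GammaE cg).
have z1i (i : nat) : z + 1 + i%:R != 0 by rewrite -addrA nat1r.
have [g' _ cg'] := Gamma_seq_cvg z1i; rewrite (GammaE cg').
have c1 : (1 + (z + 1) * (harmonic n : R)%:C : R[i]^o) @[n --> \oo] -->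
    (1 : R[i]^o).
  rewrite -[X in _ --> X]addr0 -(mulr0 (z + 1)).
  apply: cvgD; first exact: cvg_cst.
  apply: cvgMr; rewrite -(rmorph0 (real_complex R)).
  by apply: cvg_real_complex; exact: cvg_harmonic.
move: cg cg'; rewrite -(cvg_shiftn 1) -(cvg_shiftn 1 (Gamma_seq _)) => cg cg'.
have c2 : (z * Gamma_seq z (n + 1)%N : R[i]^o) @[n --> \oo] -->
    (z * g : R[i]^o) by exact: (cvgM (cvg_cst (z : R[i]^o)) cg).
have c3 : (z * Gamma_seq z (n + 1)%N : R[i]^o) @[n --> \oo] -->
    (g' : R[i]^o).
  rewrite -[g']mulr1 (_ : (fun n => _) = fun n => Gamma_seq (z + 1) (n + 1)%N *
    (1 + (z + 1) * (harmonic n : R)%:C)); first exact: cvgM cg' c1.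
  by apply/funext => n; rewrite addn1 Gamma_seq_add1.
exact: (cvg_unique (@norm_hausdorff _ R[i]^o) c3 c2).
Qed.

End GammaFunction.

(** * Linear operators on polynomials in two variables *)

Section PolynomialBasis.
Variable K : comNzRingType.
Local Notation P := (polyz K).
Implicit Types (k l : 'I_2) (p q : P) (c : K).

Section LinearMaps.
Variable A : P -> P.
Hypothesis linA : linear A.

Lemma lin0 : A 0 = 0.
Proof. by rewrite -[in LHS](subrr 0) -scaleN1r addrC linA scaleN1r addNr. Qed.

Lemma linD p q : A (p + q) = A p + A q.
Proof. by rewrite -[p in LHS]scale1r linA scale1r. Qed.

Lemma linZ c p : A (c *: p) = c *: A p.
Proof. by rewrite -[_ *: p]addr0 linA lin0 addr0. Qed.

Lemma linN p : A (- p) = - A p.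
Proof. by rewrite -scaleN1r linZ scaleN1r. Qed.

Lemma linB p q : A (p - q) = A p - A q.
Proof. by rewrite linD linN. Qed.

End LinearMaps.

Lemma ord2_cases k l i : k != l -> i = k \/ i = l.
Proof.
case: k l i => [[|[|[]//]] ?] [[|[|[]//]] ?] [[|[|[]//]] ?] //= _;
  by [left; apply/val_inj | right; apply/val_inj].
Qed.

Lemma mderiv_zvar k l : mderiv k (zvar K l) = (k == l)%:R.
Proof.
rewrite /zvar mderivX mnm1E eq_sym.
case: eqP => [->|_]; last by rewrite scale0r.
rewrite scale1r -mpolyX0; congr mpolyX; apply/mnmP => i.
by rewrite mnmBE subnn mnm0E.
Qed.

Lemma linear_ext_monomials k l (A B : P -> P) : k != l ->
  linear A -> linear B ->
  (forall i j, A (zvar K k ^+ i * zvar K l ^+ j) =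
               B (zvar K k ^+ i * zvar K l ^+ j)) -> A =1 B.
Proof.
move=> kl linA linB AB p; rewrite (mpolyE p).
elim: (msupp p) => [|m ms IH]; first by rewrite big_nil !lin0.
rewrite big_cons linA linB IH; congr (_ *: _ + _).
suff -> : mpolyX K m = zvar K k ^+ m k * zvar K l ^+ m l by exact: AB.
rewrite /zvar !mpolyXn -mpolyXD; congr mpolyX; apply/mnmP => i.
rewrite mnmDE !mulmnE !mnm1E.
have [->|->] := ord2_cases i kl; rewrite eqxx.
  by rewrite eq_sym (negbTE kl) mul1n mul0n addn0.
by rewrite (negbTE kl) mul1n mul0n add0n.
Qed.

(** The products z_l^s (z_k - z_l)^r are the eigenvectors of functions of the
    Euler operator, so identities between operators are checked on them. *)
Lemma linear_ext_diff k l (A B : P -> P) : k != l -> linear A -> linear B ->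
  (forall s r, A (zvar K l ^+ s * (zvar K k - zvar K l) ^+ r) =
               B (zvar K l ^+ s * (zvar K k - zvar K l) ^+ r)) -> A =1 B.
Proof.
move=> kl linA linB AB; apply: (linear_ext_monomials kl) => // i j.
(* An induction on i that replaces one factor z_k by (z_k - z_l) + z_l; the
   exponent of the difference has to vary. *)
suff AB' r : A (zvar K k ^+ i * (zvar K l ^+ j * (zvar K k - zvar K l) ^+ r)) =
    B (zvar K k ^+ i * (zvar K l ^+ j * (zvar K k - zvar K l) ^+ r)).
  by have := AB' 0; rewrite expr0 mulr1.
elim: i j r => [|i IH] j r; first by rewrite expr0 mul1r.
have -> : zvar K k ^+ i.+1 * (zvar K l ^+ j * (zvar K k - zvar K l) ^+ r) =
    zvar K k ^+ i * (zvar K l ^+ j.+1 * (zvar K k - zvar K l) ^+ r) +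
    zvar K k ^+ i * (zvar K l ^+ j * (zvar K k - zvar K l) ^+ r.+1).
  by rewrite !exprS; ring.
by rewrite (linD linA) (linD linB) !IH.
Qed.

End PolynomialBasis.

(** * Functions of the Euler operator *)

Section ZdfunCommutation.
Variables (K : comNzRingType) (k l : 'I_2) (kl : k != l).
Local Notation P := (polyz K).
Variables (f : nat -> K).
Implicit Types (p q : P) (s r : nat) (c : K).

Local Notation x := (zvar K l).
Local Notation w := (zvar K k - zvar K l).
Local Notation d := (mderiv k).
Local Notation D p := (mderiv k p + mderiv l p).
Local Notation T := (zdfun f k l).
Local Notation e s r := (x ^+ s * w ^+ r).

Lemma mderivXn i p r : mderiv i (p ^+ r) = r%:R *: (p ^+ r.-1 * mderiv i p).
Proof.
elim: r => [|r IH]; first by rewrite expr0 -mpolyC1 mderivC scale0r.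
rewrite exprS mderivM IH -scalerAr mulrA /=.
case: r {IH} => [|r]; first by rewrite !scale0r addr0 expr0 scale1r mul1r mulr1.
rewrite /= -exprS [mderiv i p * _]mulrC -(nat1r r.+1) scalerDl.
by rewrite scale1r.
Qed.

Lemma mderiv_diff_basis s r : d (e s r) = r%:R *: e s r.-1.
Proof.
rewrite mderivM !mderivXn mderivB !mderiv_zvar eqxx (negbTE kl).
by rewrite mulr0 scaler0 mul0r add0r subr0 mulr1 -scalerAr.
Qed.

Lemma euler_diff_basis s r : w * d (e s r) = r%:R *: e s r.
Proof.
rewrite mderiv_diff_basis -scalerAr mulrCA.
by case: r => [|r]; rewrite ?scale0r //= -exprS.
Qed.

Lemma total_mderiv_diff_basis s r : D (e s r) = s%:R *: e s.-1 r.
Proof.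
rewrite mderiv_diff_basis mderivM !mderivXn mderivB !mderiv_zvar eqxx.
rewrite [l == k]eq_sym (negbTE kl) mulr1 -scalerAl sub0r mulrN1 scalerN mulrN.
rewrite -scalerAr.
by rewrite addrCA subrr addr0.
Qed.

(** The shift c is where the parameters of the Lax matrices enter: the raising
    operators have the form w (w d_k + c), the lowering ones (w d_k + c) d_k. *)
Definition euler c p : P := w * d p + c *: p.

Lemma euler_basis c s r : euler c (e s r) = (r%:R + c) *: e s r.
Proof. by rewrite /euler euler_diff_basis -scalerDl. Qed.

Lemma mul_diff_basis s r : w * e s r = e s r.+1.
Proof. by rewrite mulrCA -exprS. Qed.

Lemma linear_mulr q : linear (fun p => q * p).
Proof. by move=> c p p'; rewrite mulrDr -scalerAr. Qed.

Lemma linear_comp (A B : P -> P) : linear A -> linear B ->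
  linear (fun p => A (B p)).
Proof. by move=> linA linB c p q; rewrite linB linA. Qed.

Lemma linear_add (A B : P -> P) : linear A -> linear B ->
  linear (fun p => A p + B p).
Proof.
by move=> linA linB c p q; rewrite linA linB addrACA -scalerDr.
Qed.

Lemma linear_scale b : linear (fun p : P => b *: p).
Proof. by move=> c p q; rewrite scalerDr !scalerA mulrC. Qed.

Let lind i : linear (mderiv i : P -> P) := @mderiv_is_linear _ _ i.

Lemma linear_euler c : linear (euler c).
Proof.
exact: linear_add (linear_comp (linear_mulr w) (lind k)) (linear_scale c).
Qed.

Let linT : linear T := @zdfun_is_linear K f k l.

(** A commutation with T is an identity of eigenvalues on the basis. *)
Lemma zdfun_comm (A B : P -> P) : linear A -> linear B ->
  (forall s r, T (A (e s r)) = f r *: B (e s r)) ->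
  forall p, T (A p) = B (T p).
Proof.
move=> linA linB AB.
apply: (linear_ext_diff kl (linear_comp linT linA) (linear_comp linB linT)).
by move=> s r; rewrite AB zdfunE// (linZ linB).
Qed.

Lemma zdfun_mul p : T (x * p) = x * T p.
Proof.
apply: zdfun_comm p => [||s r]; try exact: linear_mulr.
by rewrite mulrA -exprS zdfunE.
Qed.

Lemma zdfun_total_mderiv p : T (D p) = D (T p).
Proof.
apply: (@zdfun_comm (fun p => D p) (fun p => D p)) p => [||s r].
- exact: linear_add.
- exact: linear_add.
- by rewrite total_mderiv_diff_basis (linZ linT) zdfunE// !scalerA mulrC.
Qed.

Lemma zdfun_euler c p : T (euler c p) = euler c (T p).
Proof.
apply: (zdfun_comm (linear_euler c) (linear_euler c)) => s r.
by rewrite euler_basis (linZ linT) zdfunE// !scalerA mulrC.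
Qed.

Variables (alpha beta : K).
Hypothesis frec : forall r, (r%:R + beta) * f r.+1 = (r%:R + alpha) * f r.

(** On w^r both sides are multiples of w^(r+1), and their equality is the
    recurrence at r. *)
Lemma zdfun_raise p : T (w * euler beta p) = w * euler alpha (T p).
Proof.
have lin c := linear_comp (linear_mulr w) (linear_euler c).
apply: (zdfun_comm (lin _) (lin _)) => s r.
rewrite !euler_basis !(linZ (linear_mulr _)) !mul_diff_basis (linZ linT).
by rewrite zdfunE// !scalerA frec mulrC.
Qed.

(** The shifts change roles with respect to [zdfun_raise]: on w^(r+1) the
    recurrence at r is read from right to left. *)
Lemma zdfun_lower p : T (euler alpha (d p)) = euler beta (d (T p)).
Proof.
have lin c := linear_comp (linear_euler c) (lind k).
apply: (zdfun_comm (lin _) (lin _)) => s r.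
rewrite !mderiv_diff_basis !(linZ (linear_euler _)) !euler_basis !(linZ linT).
case: r => [|r]; first by rewrite !scale0r scaler0.
rewrite zdfunE// !scalerA; congr (_ *: _).
by rewrite -mulrA -frec; ring.
Qed.

End ZdfunCommutation.

(** * Products of Lax matrices *)

Section LaxProducts.
Variable K : comNzRingType.
Local Notation P := (polyz K).
Implicit Types (a b c d : K) (p q x : P) (M : opmx K).

Definition opmx2 (A B C E : P -> P) : opmx K :=
  \matrix_(i, j) match val i, val j with
    | 0, 0 => A | 0, _ => B | _, 0 => C | _, _ => E end.

(** This is Z M Z^-1, where Z is unipotent lower triangular with lower left
    entry the operator of multiplication by x. Any operator that commutes with x
    commutes with Z, so intertwining relations for M and for its conjugate are
    equivalent. *)
Definition unip_conj x M : opmx K :=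
  opmx2 (fun p => M i1 i1 p - M i1 i2 (x * p))
        (M i1 i2)
        (fun p => x * (M i1 i1 p - M i1 i2 (x * p)) +
                  (M i2 i1 p - M i2 i2 (x * p)))
        (fun p => x * M i1 i2 p + M i2 i2 p).

Lemma opmx_eq2 (M M' : opmx K) :
  M i1 i1 =1 M' i1 i1 -> M i1 i2 =1 M' i1 i2 ->
  M i2 i1 =1 M' i2 i1 -> M i2 i2 =1 M' i2 i2 -> M = M'.
Proof.
move=> E11 E12 E21 E22; apply/matrixP => i j; apply/funext => p.
have i12 : i1 != i2 by [].
by have [->|->] := ord2_cases i i12; have [->|->] := ord2_cases j i12.
Qed.

Lemma mul_opmxE (M M' : opmx K) i j p :
  mul_opmx M M' i j p = M i i1 (M' i1 j p) + M i i2 (M' i2 j p).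
Proof.
rewrite mxE !big_ord_recl big_ord0 addr0.
by congr (M _ _ (M' _ _ _) + M _ _ (M' _ _ _)); apply/val_inj.
Qed.

(** With L(a, b) = Z T(a, b) Z^-1 for the upper triangular T(a, b) with diagonal
    (a - 1, b) and upper right entry minus the derivative, this is T_1(a, b)
    times the conjugate of T_2(c, d) by Z_1^-1 Z_2. Its entries are grouped so
    that exchanging a and c is visible: the upper left one is symmetric in them
    except for the raising part S. *)
Definition core1 a b c d : opmx K :=
  let N := euler i2 i1 0 in
  let S p := (zvar K i2 - zvar K i1) * euler i2 i1 (c - d) p in
  opmx2
    (fun p => N (N p) + (a + c - d) *: N p + (a * c - d) *: p
              - (mderiv i2 (S p) + mderiv i1 (S p)))
    (fun p => (mderiv i2 (N p - d *: p) + mderiv i1 (N p - d *: p))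
              - euler i2 i1 (a - d) (mderiv i2 p))
    (fun p => b *: S p)
    (fun p => b *: (d *: p - N p)).

(** Same factorization, conjugated by Z_2 instead of Z_1; the exchange to be
    seen is that of b and d. *)
Definition core2 a b c d : opmx K :=
  let N := euler i1 i2 0 in
  let S p := (zvar K i1 - zvar K i2) * euler i1 i2 (a - b) p in
  let D p := mderiv i1 p + mderiv i2 p in
  opmx2
    (fun p => (c - 1) *: euler i1 i2 a p)
    (fun p => euler i1 i2 (a - d) (mderiv i1 p) - euler i1 i2 a (D p))
    (fun p => (c - 1) *: S p)
    (fun p => N (N p) + (a - b - d - 1) *: N p + (b * d) *: p - S (D p)).

Let mderivE := (@mderivD, @mderivB, @mderivN, @mderivM, @mderivC,
  @mderiv_zvar).

(** After the Leibniz rule the goal is a commutative ring identity between the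
    iterated derivatives of p, the variables and the parameters; abstracting
    them keeps [ring] from looking inside polynomials. *)
Ltac expand_and_ring :=
  rewrite ?expr2 !mderivE /= ?[mderiv i1 (mderiv i2 _)]mderiv_comm;
  rewrite ?(mpolyCD, mpolyCN, mpolyCM, mpolyC0, mpolyC1);
  repeat match goal with
  | |- context [mderiv ?i (mderiv ?j ?p)] => move: (mderiv i (mderiv j p)) => ?
  end;
  repeat match goal with
  | |- context [mderiv ?i ?p] => move: (mderiv i p) => ?
  | |- context [zvar _ ?i] => move: (zvar _ i) => ?
  | |- context [mpolyC _ ?a] => move: (mpolyC _ a) => ?
  end;
  ring.

Lemma Lax_mul1 a b c d :
  mul_opmx (Lax i1 a b) (Lax i2 c d) = unip_conj (zvar K i1) (core1 a b c d).
Proof.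
apply: opmx_eq2 => p; rewrite mul_opmxE !mxE /= /euler -!mul_mpolyC;
  expand_and_ring.
Qed.

Lemma Lax_mul2 a b c d :
  mul_opmx (Lax i1 a b) (Lax i2 c d) = unip_conj (zvar K i2) (core2 a b c d).
Proof.
apply: opmx_eq2 => p; rewrite mul_opmxE !mxE /= /euler -!mul_mpolyC;
  expand_and_ring.
Qed.

End LaxProducts.

(** * Exchange of parameters *)

Section Intertwining.
Variable K : comNzRingType.
Local Notation P := (polyz K).
Implicit Types (a b c d : K) (p q x : P) (M : opmx K).

Definition intertwines (T : P -> P) M M' :=
  forall i j p, T (M i j p) = M' i j (T p).

Lemma unip_conj_intertwines (T : P -> P) x M M' : linear T ->
  (forall p, T (x * p) = x * T p) -> intertwines T M M' ->
  intertwines T (unip_conj x M) (unip_conj x M').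
Proof.
move=> linT Tx TM i j p; have i12 : i1 != i2 by [].
by have [->|->] := ord2_cases i i12; have [->|->] := ord2_cases j i12;
  rewrite !mxE /= ?(linD linT) ?(linN linT) ?Tx ?(linD linT) ?(linN linT)
    !TM ?Tx.
Qed.

Lemma intertwines_opmx2 (T A B C E A' B' C' E' : P -> P) :
  (forall p, T (A p) = A' (T p)) -> (forall p, T (B p) = B' (T p)) ->
  (forall p, T (C p) = C' (T p)) -> (forall p, T (E p) = E' (T p)) ->
  intertwines T (opmx2 A B C E) (opmx2 A' B' C' E').
Proof.
move=> TA TB TC TE i j p; have i12 : i1 != i2 by [].
by have [->|->] := ord2_cases i i12; have [->|->] := ord2_cases j i12;
  rewrite !mxE /=.
Qed.

(** The raising and lowering entries of [core1] carry the shifts alpha = a - d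
    and beta = c - d, so their swap is the exchange of a and c. *)
Lemma zdfun_intertwines1 (f : nat -> K) a b c d :
  (forall r, (r%:R + (c - d)) * f r.+1 = (r%:R + (a - d)) * f r) ->
  intertwines (zdfun f i2 i1) (mul_opmx (Lax i1 a b) (Lax i2 c d))
                              (mul_opmx (Lax i1 c b) (Lax i2 a d)).
Proof.
move=> frec; rewrite !Lax_mul1.
have i21 : i2 != i1 by [].
have linT := @zdfun_is_linear K f i2 i1.
have TN := zdfun_euler i21 f; have TD := zdfun_total_mderiv i21 f.
have TS := zdfun_raise i21 frec; have TV := zdfun_lower i21 frec.
apply: unip_conj_intertwines => //; first exact: zdfun_mul.
apply: intertwines_opmx2 => p /=.
- rewrite (linB linT) TD TS 2!(linD linT) !(linZ linT) !TN.
  by rewrite (addrC c a) (mulrC c a).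
- by rewrite (linB linT) TD TV (linB linT) (linZ linT) TN.
- by rewrite (linZ linT) TS.
- by rewrite (linZ linT) (linB linT) (linZ linT) TN.
Qed.

(** In [core2] the shifts are alpha = a - d and beta = a - b, so their swap is
    the exchange of b and d. *)
Lemma zdfun_intertwines2 (f : nat -> K) a b c d :
  (forall r, (r%:R + (a - b)) * f r.+1 = (r%:R + (a - d)) * f r) ->
  intertwines (zdfun f i1 i2) (mul_opmx (Lax i1 a b) (Lax i2 c d))
                              (mul_opmx (Lax i1 a d) (Lax i2 c b)).
Proof.
move=> frec; rewrite !Lax_mul2.
have i12 : i1 != i2 by [].
have linT := @zdfun_is_linear K f i1 i2.
have TN := zdfun_euler i12 f; have TD := zdfun_total_mderiv i12 f.
have TS := zdfun_raise i12 frec; have TV := zdfun_lower i12 frec.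
apply: unip_conj_intertwines => //; first exact: zdfun_mul.
apply: intertwines_opmx2 => p /=.
- by rewrite (linZ linT) TN.
- by rewrite (linB linT) TV TN TD.
- by rewrite (linZ linT) TS.
- rewrite (linB linT) TS TD 2!(linD linT) !(linZ linT) !TN.
  by rewrite (mulrC d b) [a - d - b]addrAC.
Qed.

End Intertwining.

(** * Intertwiners are determined by their value at 1 *)

Section Uniqueness.
Variable K : fieldType.
Local Notation P := (polyz K).
Implicit Types (a b c d : K) (p q x : P).

(** Adding h to the four parameters changes only the two factors c + j
    and b - i, so a suitable h isolates either of the two monomials. *)
Lemma Lax_mul_raise a b c d i j :
  mul_opmx (Lax i1 a b) (Lax i2 c d) i2 i1 (zvar K i1 ^+ i * zvar K i2 ^+ j) =
  ((c + j%:R) * (i%:R + a - b)) *: (zvar K i1 ^+ i.+1 * zvar K i2 ^+ j) +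
  ((b - i%:R) * (j%:R + c - d)) *: (zvar K i1 ^+ i * zvar K i2 ^+ j.+1).
Proof.
have D1 i' j' : zvar K i1 * mderiv i1 (zvar K i1 ^+ i' * zvar K i2 ^+ j') =
    i'%:R *: (zvar K i1 ^+ i' * zvar K i2 ^+ j').
  rewrite mderivM !mderivXn !mderiv_zvar /= mulr0 scaler0 mulr0 addr0 mulr1.
  rewrite -scalerAl -scalerAr mulrA.
  by case: i' => [|i']; rewrite ?scale0r//= -exprS.
have D2 : zvar K i2 * mderiv i2 (zvar K i1 ^+ i * zvar K i2 ^+ j) =
    j%:R *: (zvar K i1 ^+ i * zvar K i2 ^+ j).
  rewrite mderivM !mderivXn !mderiv_zvar /= mulr0 scaler0 mul0r add0r mulr1.
  rewrite -!scalerAr mulrCA.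
  by case: j => [|j']; rewrite ?scale0r//= -exprS.
have z1 : zvar K i1 * (zvar K i1 ^+ i * zvar K i2 ^+ j) =
    zvar K i1 ^+ i.+1 * zvar K i2 ^+ j by rewrite mulrA -exprS.
have z2 : zvar K i2 * (zvar K i1 ^+ i * zvar K i2 ^+ j) =
    zvar K i1 ^+ i * zvar K i2 ^+ j.+1 by rewrite mulrCA -exprS.
have D11 : zvar K i1 ^+ 2 * mderiv i1 (zvar K i1 ^+ i * zvar K i2 ^+ j) =
    i%:R *: (zvar K i1 ^+ i.+1 * zvar K i2 ^+ j).
  by rewrite (expr2 (zvar K i1)) -mulrA D1 -scalerAr z1.
have D22 : zvar K i2 ^+ 2 * mderiv i2 (zvar K i1 ^+ i * zvar K i2 ^+ j) =
    j%:R *: (zvar K i1 ^+ i * zvar K i2 ^+ j.+1).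
  by rewrite (expr2 (zvar K i2)) -mulrA D2 -scalerAr z2.
rewrite mul_opmxE !mxE /= D2 D22 z2 -!scalerDl !mderivZ.
rewrite -!scalerAr D11 D1 z1 !scalerA -scalerDl -scalerBl.
congr (_ *: _ + _ *: _); ring.
Qed.

(** The values of the lower left entry at all shifts h generate every monomial
    from 1. *)
Lemma intertwiner_unique a b c d (M' : K -> P -> P) (X Y : P -> P) :
  linear X -> linear Y ->
  (forall i : nat, a - b + i%:R != 0) -> (forall j : nat, c - d + j%:R != 0) ->
  (forall n : nat, c - b + n%:R != 0) ->
  let M h := mul_opmx (Lax i1 (a + h) (b + h)) (Lax i2 (c + h) (d + h)) in
  (forall h p, X (M h i2 i1 p) = M' h (X p)) ->
  (forall h p, Y (M h i2 i1 p) = M' h (Y p)) ->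
  X 1 = Y 1 -> X =1 Y.
Proof.
move=> linX linY ab cd cb M XM YM XY1.
have i12 : i1 != i2 by [].
pose e i j : P := zvar K i1 ^+ i * zvar K i2 ^+ j.
have step h s p q : M h i2 i1 p = s *: q -> s != 0 -> X p = Y p -> X q = Y q.
  move=> Mpq s0 XYp; apply: (scalerI s0).
  by rewrite -(linZ linX) -(linZ linY) -Mpq XM YM XYp.
apply: (linear_ext_monomials i12) => // i j.
elim: i j => [|i IH] j.
  elim: j => [|j IH]; first by rewrite !expr0 mulr1.
  (* Here h = - c - j cancels the first term of [Lax_mul_raise]. *)
  apply: (step (- c - j%:R) ((b - c - j%:R) * (c - d + j%:R))) IH.
    rewrite /M Lax_mul_raise.
    have -> : c + (- c - j%:R) + j%:R = 0 by ring.
    rewrite mul0r scale0r add0r; congr (_ *: _); ring.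
  rewrite mulf_neq0//; have -> : b - c - j%:R = - (c - b + j%:R) by ring.
  by rewrite oppr_eq0.
(* Here h = i - b cancels its second term. *)
apply: (step (i%:R - b) ((c - b + (i + j)%:R) * (a - b + i%:R))) (IH j).
  rewrite /M Lax_mul_raise.
  have -> : b + (i%:R - b) - i%:R = 0 by ring.
  rewrite mul0r scale0r addr0 natrD; congr (_ *: _); ring.
by rewrite mulf_neq0.
Qed.

End Uniqueness.

(** * The elementary operators with Gamma functions *)

Section CalR.
Variable R : realType.
Local Notation C := R[i].
Implicit Types (a b c d h s t : C).

Lemma Gamma_ratio_rec s t (r : nat) :
  (forall i : nat, s + i%:R != 0) -> (forall i : nat, t + i%:R != 0) ->
  (r%:R + t) * (Gamma (r.+1%:R + s) / Gamma (r.+1%:R + t)) =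
  (r%:R + s) * (Gamma (r%:R + s) / Gamma (r%:R + t)).
Proof.
move=> s0 t0.
have shift w : (forall i : nat, w + i%:R != 0) ->
    forall i : nat, r%:R + w + i%:R != 0 :> C.
  by move=> w0 i; rewrite addrAC addrC -natrD.
have step w : r.+1%:R + w = r%:R + w + 1 by rewrite -natr1 addrAC.
rewrite !step !GammaS; try exact: shift.
have G0 := Gamma_neq0 (shift _ t0).
have t0' : r%:R + t != 0 by rewrite addrC.
by move: (Gamma (r%:R + s)) (Gamma _) G0 => x y y0; field; rewrite y0 t0'.
Qed.

Lemma nonint_diff_sym a b : nonint_diff a b -> nonint_diff b a.
Proof.
move=> ab n; apply: contra_neq (ab (- n)) => E.
by rewrite rmorphN /= -E opprB.
Qed.

Lemma nonint_diff_addn a b : nonint_diff a b ->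
  forall i : nat, a - b + i%:R != 0.
Proof.
move=> ab i; rewrite addr_eq0; have := ab (- (i%:Z)).
by rewrite rmorphN /= -pmulrn.
Qed.

Lemma subDD a b h : a + h - (b + h) = a - b.
Proof. by rewrite opprD addrACA subrr addr0. Qed.

(** The common shift h is kept because
    [intertwiner_unique] uses all its values. *)
Lemma calR1_intertwines a b c d h : nonint_diff a d -> nonint_diff c d ->
  intertwines (calR1 a c d)
    (mul_opmx (Lax i1 (a + h) (b + h)) (Lax i2 (c + h) (d + h)))
    (mul_opmx (Lax i1 (c + h) (b + h)) (Lax i2 (a + h) (d + h))).
Proof.
move=> ad cd; apply: zdfun_intertwines1 => r.
rewrite !subDD -!addrA; apply: Gamma_ratio_rec; exact: nonint_diff_addn.
Qed.

Lemma calR2_intertwines a b c d h : nonint_diff a d -> nonint_diff a b ->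
  intertwines (calR2 a b d)
    (mul_opmx (Lax i1 (a + h) (b + h)) (Lax i2 (c + h) (d + h)))
    (mul_opmx (Lax i1 (a + h) (d + h)) (Lax i2 (c + h) (b + h))).
Proof.
move=> ad ab; apply: zdfun_intertwines2 => r.
rewrite !subDD -!addrA; apply: Gamma_ratio_rec; exact: nonint_diff_addn.
Qed.

Lemma zdfun1 (f : nat -> C) k l : k != l -> zdfun f k l 1 = f 0 *: 1.
Proof. by move=> kl; have := zdfunE f 0 0 kl; rewrite !expr0 mulr1. Qed.

Lemma calR1_1 a b c :
  calR1 a b c 1 = (Gamma (a - c) / Gamma (b - c)) *: 1.
Proof. by apply: etrans (zdfun1 _ _) _ => //; rewrite !add0r. Qed.

Lemma calR1_1Z a b c s : calR1 a b c (s *: 1) =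
  (s * (Gamma (a - c) / Gamma (b - c))) *: 1.
Proof.
by apply: etrans (linZ (@zdfun_is_linear _ _ _ _) s 1) _;
  rewrite calR1_1 scalerA.
Qed.

Lemma calR2_1 a b c :
  calR2 a b c 1 = (Gamma (a - c) / Gamma (a - b)) *: 1.
Proof. by apply: etrans (zdfun1 _ _) _ => //; rewrite !add0r. Qed.

Lemma calR2_1Z a b c s : calR2 a b c (s *: 1) =
  (s * (Gamma (a - c) / Gamma (a - b))) *: 1.
Proof.
by apply: etrans (linZ (@zdfun_is_linear _ _ _ _) s 1) _;
  rewrite calR2_1 scalerA.
Qed.

(** The star-triangle relation: both sides intertwine the same Lax products at
    every shift h, and they agree at 1. *)
Lemma calR_star_triangle (u1 u2 v1 v2 : C) : generic u1 u2 v1 v2 ->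
  forall p, calR1 u1 v1 u2 (calR2 u1 u2 v2 p) =
            calR2 v1 u2 v2 (calR1 u1 v1 v2 p).
Proof.
move=> [[u12 u1v1 u1v2] [u2v1 u2v2 v12]].
have v1u2 := nonint_diff_sym u2v1.
pose M' h := mul_opmx (Lax i1 (v1 + h) (v2 + h)) (Lax i2 (u1 + h) (u2 + h)).
apply: (@intertwiner_unique _ u1 u2 v1 v2 (fun h => M' h i2 i1)
  (fun p => calR1 u1 v1 u2 (calR2 u1 u2 v2 p))
  (fun p => calR2 v1 u2 v2 (calR1 u1 v1 v2 p))).
- exact: linear_comp (@zdfun_is_linear _ _ _ _) (@zdfun_is_linear _ _ _ _).
- exact: linear_comp (@zdfun_is_linear _ _ _ _) (@zdfun_is_linear _ _ _ _).
- exact: nonint_diff_addn.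
- exact: nonint_diff_addn.
- exact: nonint_diff_addn.
- move=> h p; apply: (etrans (congr1 _ _)).
    exact: (calR2_intertwines v1 h u1v2 u12).
  exact: (calR1_intertwines v2 h u12 v1u2).
- move=> h p; apply: (etrans (congr1 _ _)).
    exact: (calR1_intertwines u2 h u1v2 v12).
  exact: (calR2_intertwines u1 h v12 v1u2).
have X1 := etrans (congr1 (calR1 u1 v1 u2) (calR2_1 u1 u2 v2))
  (calR1_1Z _ _ _ _).
have Y1 := etrans (congr1 (calR2 v1 u2 v2) (calR1_1 u1 v1 v2))
  (calR2_1Z _ _ _ _).
apply: (etrans X1); apply: (etrans _ (esym Y1)); congr (_ *: _).
have G0 a b : nonint_diff a b -> Gamma (a - b) != 0.
  by move=> ab; apply: Gamma_neq0; exact: nonint_diff_addn.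
move: (G0 _ _ u12) (G0 _ _ v1u2) (G0 _ _ v12).
move: (Gamma (u1 - u2)) (Gamma (v1 - u2)) (Gamma (v1 - v2)) (Gamma _).
by move=> x y z t x0 y0 z0; field; rewrite x0 y0 z0.
Qed.

End CalR.

Theorem proposition3 (R : realType) (u1 u2 v1 v2 : R[i])
    (hgen : generic u1 u2 v1 v2) :
  exists Rcheck : {linear polyz R[i] -> polyz R[i]},
    [/\ lcomp_opmx Rcheck (mul_opmx (Lax i1 u1 u2) (Lax i2 v1 v2)) =
        rcomp_opmx (mul_opmx (Lax i1 v1 v2) (Lax i2 u1 u2)) Rcheck,
        exists c : R[i], c != 0 /\
          forall p, Rcheck p = c *: calR1 u1 v1 u2 (calR2 u1 u2 v2 p)
      & exists c : R[i], c != 0 /\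
          forall p, Rcheck p = c *: calR2 v1 u2 v2 (calR1 u1 v1 v2 p)].
Proof.
exists (calR1 u1 v1 u2 \o calR2 u1 u2 v2); split.
- have [[u12 _ u1v2] [u2v1 _ _]] := hgen.
  have R2M := calR2_intertwines v1 0 u1v2 u12.
  have R1M := calR1_intertwines v2 0 u12 (nonint_diff_sym u2v1).
  rewrite !addr0 in R1M R2M.
  apply/matrixP => i j; rewrite [LHS]mxE [RHS]mxE; apply/funext => p.
  exact: (etrans (congr1 _ (R2M i j p)) (R1M i j _)).
- by exists 1; rewrite oner_neq0; split=> // p; rewrite scale1r.
- exists 1; rewrite oner_neq0; split=> // p; rewrite scale1r.
  exact: (calR_star_triangle hgen p).
Qed.
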